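(* Let $\ell\geq 2$ and $n\geq 0$. There is an equality of multisets $$\{\,r_\ell(\mu)\mid \mu\in\mathrm{Par}_\ell(n)\,\}=\{\,\vartheta_\ell(\lambda)\text{ with multiplicity } m_\ell^n(d)\mid \lambda\in\mathrm{Par}(d),\ 0\leq d\leq\lfloor n/\ell\rfloor\,\},$$ i.e. for every $\lambda\in\mathrm{Par}(d)$ with $d\le\lfloor n/\ell\rfloor$ the value $\vartheta_\ell(\lambda)$ is counted $m_\ell^n(d)$ times, and the resulting multiset coincides with the multiset of values $r_\ell(\mu)$ over the $\ell$-class regular partitions $\mu$ of $n$.
   Context: $\mathrm{Par}(d)$ is the set of partitions of $d$ and $\mathrm{Par}_\ell(n)$ the set of $\ell$-class regular partitions of $n$ (no part divisible by $\ell$); $m_k(\lambda)$ denotes the multiplicity of $k$ as a part of $\lambda$. $P(q)=\prod_{i\ge1}(1-q^i)^{-1}$, $P_\ell(q)=P(q)/P(q^\ell)$, and $m_\ell^n(d)$ is the coefficient of $q^{n-\ell d}$ in $P_\ell(q)/P(q^\ell)$. For an integer $k\geq1$ put $\ell_k=\ell/\gcd(\ell,k)$ and let $\pi_k$ be the set of primes dividing $\ell_k$; for a set of primes $\pi$ and an integer $a$, $a_\pi=\prod_{p\in\pi}a_p$ is the $\pi$-part of $a$. Define $r_\ell(\mu)=\prod_{k\geq1}\ell_k^{\lfloor m_k(\mu)/\ell\rfloor}\,\big(\lfloor m_k(\mu)/\ell\rfloor!\big)_{\pi_k}$. For a prime $p$, $\nu_p$ is the $p$-adic valuation and $d_p(a)=\sum_{j\geq1}\lfloor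 a/p^j\rfloor$; for $r\geq1$, $\vartheta_{p^r}(\lambda)=\prod_{n\geq1,\ 0\leq\nu_p(n)<r}p^{(r-\nu_p(n))m_n(\lambda)+d_p(m_n(\lambda))}$. If $\ell=\prod_{i=1}^s p_i^{r_i}$ is the prime factorization, $\vartheta_\ell(\lambda)=\prod_{i=1}^s\vartheta_{p_i^{r_i}}(\lambda)$. *)

(* Defs.v *)
From mathcomp Require Import all_boot all_order all_algebra.
Set Implicit Arguments. Unset Strict Implicit. Unset Printing Implicit Defensive.
Import GRing.Theory.

(* Partitions are represented as non-increasing sequences of positive parts. *)
(* part_bnd f k n: all partitions of n with all parts <= k, listed as
   non-increasing sequences (fuel f >= n suffices). *)
Fixpoint part_bnd (f k n : nat) : seq (seq nat) :=
  if n == 0 then [:: [::]] else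
  match f with
  | 0 => [::]
  | f'.+1 => flatten [seq [seq i :: s | s <- part_bnd f' i (n - i)]
                     | i <- iota 1 (minn k n)]
  end.

Definition partitions (n : nat) : seq (seq nat) := part_bnd n n n.

Definition reg_partitions (l n : nat) : seq (seq nat) :=
  [seq mu <- partitions n | all (fun k => ~~ (l %| k)) mu].

Definition mult (k : nat) (la : seq nat) : nat := count_mem k la.

Definition lk (l k : nat) : nat := l %/ gcdn l k.

(* r_l(mu) = prod_{k>=1} l_k^{floor(m_k/l)} (floor(m_k/l)!)_{pi_k};
   factors with k > |mu| have m_k = 0 and are 1. *)
Definition r_l (l : nat) (mu : seq nat) : nat :=
  \prod_(1 <= k < (sumn mu).+1)
     (lk l k ^ (mult k mu %/ l) * ((mult k mu %/ l)`!)`_(\pi(lk l k))).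

(* d_p(a) = sum_{j>=1} floor(a/p^j)  (terms with j > a vanish for p >= 2) *)
Definition d_p (p a : nat) : nat := \sum_(1 <= j < a.+1) a %/ p ^ j.

Definition theta_pr (p r : nat) (la : seq nat) : nat :=
  \prod_(1 <= k < (sumn la).+1 | logn p k < r)
     p ^ ((r - logn p k) * mult k la + d_p p (mult k la)).

Definition theta (l : nat) (la : seq nat) : nat :=
  \prod_(p <- primes l) theta_pr p (logn p l) la.

(* m_l^n(d): coefficient of q^(n - l d) in P_l(q)/P(q^l) = P(q) * prod_i (1-q^(l i))^2.
   For the coefficient of q^N it suffices to truncate: factors with i > N are
   1 mod q^(N+1), and (1-q^i)^(-1) = sum_j q^(i j) may be truncated at j <= N. *)
Definition coefPl (l N : nat) : int :=
  ((\prod_(1 <= i < N.+1) (\sum_(j < N.+1) 'X^(i * j) : {poly int}))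
   * (\prod_(1 <= i < N.+1) (1 - 'X^(l * i)) ^+ 2))`_N.

Definition mlnd (l n d : nat) : int := coefPl l (n - l * d).

(* Main.v *)
(* Put w_k(a) = l_k^a (a!)_{pi_k}. Comparing p-adic valuations prime by prime,
   theta_l(la) = prod_k w_k(m_k(la)), while r_l(mu) = prod_k w_k(floor(m_k(mu)/l)).
   For l not dividing k, writing m = l a + b with b < l gives
     sum_m w_k(floor(m/l)) q^(k m)
       = (1 - q^(l k)) / (1 - q^k) * sum_a w_k(a) (q^l)^(k a),
   and w_k = 1 when l divides k. Taking the product over k, the generating function
   of the regular partitions weighted by r_l is that of all partitions weighted by
   theta_l, taken at q^l, times P(q) / P(q^l)^2. The same holds for the s-th powers
   of the weights, for every s, so both multisets have the same power sums and hence
   are equal. Power series are handled as polynomials modulo a power of X. *)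
Require Import Defs.
From mathcomp Require Import all_boot all_order all_algebra.
From mathcomp Require Import zify ring.
Set Implicit Arguments.
Unset Strict Implicit.
Unset Printing Implicit Defensive.
Import GRing.Theory.
Local Open Scope ring_scope.

(** * Enumeration of partitions by multiplicities, and the resulting product formula *)

Lemma part_bnd0 f k : part_bnd f k 0 = [:: [::]].
Proof. by case: f. Qed.

Lemma part_bnd_fuel f g k n : (n <= f)%N -> (n <= g)%N ->
  part_bnd f k n = part_bnd g k n.
Proof.
elim: f g k n => [|f IHf] [|g] k [|n] //= lenf leng.
congr flatten; apply/eq_in_map => i; rewrite mem_iota => Hi.
by rewrite (IHf g) //; lia.
Qed.

Lemma part_bnd_le k n : (n <= k)%N -> part_bnd n k n = partitions n.
Proof.
by case: n => // n lenk; rewrite /partitions /= (minn_idPr lenk) minnn.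
Qed.

(** The enumeration is grouped by first part, which is the largest; raising the bound to [k.+1]
    therefore only appends the block of partitions starting with [k.+1]. *)
Lemma part_bndS k n : (0 < n)%N -> part_bnd n k.+1 n = part_bnd n k n ++
  (if (k.+1 <= n)%N then
     [seq k.+1 :: s | s <- part_bnd (n - k.+1) k.+1 (n - k.+1)] else [::]).
Proof.
case: n => // n _; case: ifPn => [ltkn | ]; last first.
  by rewrite -leqNgt => lenk; rewrite cats0 !part_bnd_le ?leqW.
rewrite /= (minn_idPl ltkn) (minn_idPl (ltnW ltkn)) -[X in iota _ X]addn1 iotaD.
rewrite map_cat flatten_cat /= cats0 addnC addn1; congr (_ ++ _).
by congr map; apply: part_bnd_fuel; lia.
Qed.

Lemma part_bndP f k n s : s \in part_bnd f k n ->
  all (fun j => 0 < j <= k)%N s /\ sumn s = n.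
Proof.
elim: f k n s => [|f IHf] k [|n] s //=; rewrite ?inE; try by move/eqP->.
case/flattenP => _ /mapP[i + ->] /mapP[t /IHf[allt sumt] ->].
rewrite mem_iota => Hi /=; split; last by rewrite sumt; lia.
apply/andP; split; first by lia.
by apply: sub_all allt => j; lia.
Qed.

Lemma partitionsP n s : s \in partitions n ->
  all (fun j => 0 < j <= n)%N s /\ sumn s = n.
Proof. exact: part_bndP. Qed.

Lemma sum_part_bnd0 (V : nmodType) n (g : seq nat -> V) :
  \sum_(s <- part_bnd n 0 n) g s = if n == 0%N then g [::] else 0.
Proof. by case: n => [|n] /=; rewrite ?big_seq1 ?big_nil. Qed.

(** The copies of [k.+1] head the list and are peeled off one at a time. [M] is independent of [n],
    so one truncation serves all degrees up to it. *)
Lemma sum_part_bndS (V : nmodType) k n M (g : seq nat -> V) : (n <= M)%N ->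
  \sum_(s <- part_bnd n k.+1 n) g s =
  \sum_(m < M.+1 | (k.+1 * m <= n)%N)
     \sum_(s <- part_bnd (n - k.+1 * m) k (n - k.+1 * m)) g (nseq m k.+1 ++ s).
Proof.
elim/ltn_ind: n M g => -[|n] IHn M g leNM.
  rewrite (big_pred1 ord0) ?muln0 ?part_bnd0 ?big_seq1 //.
  by move=> m /=; rewrite -val_eqE /=; lia.
rewrite part_bndS // big_cat /= [RHS]big_mkcond big_ord_recl /= muln0 subn0.
congr (_ + _); case: ifPn => [ltkn | lenk]; last first.
  rewrite big_nil big1 // => i _; rewrite /bump /= ifF //.
  by apply/negbTE; rewrite -ltnNge mulnDr muln1; lia.
case: M leNM => // M leNM.
rewrite big_map (IHn _ _ M); [|lia|lia].
rewrite big_mkcond; apply: eq_bigr => i _; rewrite /bump /= mulnDr muln1.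
rewrite leq_subRL // subnDA //=.
Qed.

Lemma mult_notin k la : k \notin la -> mult k la = 0%N.
Proof. by rewrite /mult; move/count_memPn. Qed.

(** Choosing a term in the last factor fixes the multiplicity of the largest allowed part, so
    induction on [k] follows [sum_part_bndS]. *)
Lemma coef_prod_part (R : comNzRingType) (F : nat -> nat -> R) k n M :
  (n <= M)%N ->
  (\prod_(1 <= j < k.+1) (\sum_(m < M.+1) F j m *: 'X^(j * m)))`_n =
  \sum_(s <- part_bnd n k n) \prod_(1 <= j < k.+1) F j (mult j s).
Proof.
elim: k n => [|k IHk] n leNM.
  by rewrite sum_part_bnd0 !big_nil coef1; case: eqP.
rewrite (sum_part_bndS _ _ leNM) big_nat_recr //= mulr_sumr coef_sum.
rewrite [RHS]big_mkcond; apply: eq_bigr => m _.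
rewrite -scalerAr coefZ coefMXn; case: leqP => _ /=; last by rewrite ?mulr0.
rewrite IHk ?(leq_trans (leq_subr _ _)) // mulr_sumr.
rewrite big_seq [RHS]big_seq; apply: eq_bigr => s /part_bndP[/allP Hs _].
rewrite [RHS]big_nat_recr //= mulrC; congr (_ * _).
  apply: eq_big_nat => j /andP[_ ltjk]; rewrite /mult count_cat count_nseq /=.
  by rewrite [k.+1 == j]eq_sym ltn_eqF.
rewrite /mult count_cat count_nseq /= eqxx mul1n (count_memPn _) ?addn0 //.
by apply/negP => /Hs; rewrite ltnn andbF.
Qed.

Lemma prod_mult_widen (R : comNzRingType) (F : nat -> nat -> R) k n s :
  (forall j, F j 0 = 1) -> s \in partitions n -> (n <= k)%N ->
  \prod_(1 <= j < k.+1) F j (mult j s) = \prod_(1 <= j < n.+1) F j (mult j s).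
Proof.
move=> F0 /partitionsP[/allP Hs _] lenk.
rewrite (@big_cat_nat _ _ _ n.+1) //= -[RHS]mulr1; congr (_ * _).
rewrite big_nat_cond big1 // => j /andP[/andP[ltnj _] _].
by rewrite mult_notin //; apply/negP => /Hs; lia.
Qed.

Lemma coef_prod_partitions (R : comNzRingType) (F : nat -> nat -> R) k n :
  (forall j, F j 0 = 1) -> (n <= k)%N ->
  (\prod_(1 <= j < k.+1) (\sum_(m < k.+1) F j m *: 'X^(j * m)))`_n =
  \sum_(s <- partitions n) \prod_(1 <= j < n.+1) F j (mult j s).
Proof.
move=> F0 lenk; rewrite coef_prod_part // part_bnd_le //.
rewrite big_seq [RHS]big_seq; apply: eq_bigr => s Hs.
exact: prod_mult_widen.
Qed.

(** * Congruence of polynomials modulo a power of X *)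

Definition eqX (R : nzRingType) n (p q : {poly R}) :=
  forall i, (i < n)%N -> p`_i = q`_i.

Section EqX.
Variables (R : comNzRingType) (n : nat).
Implicit Types p q : {poly R}.

Lemma eqX_refl p : eqX n p p. Proof. by []. Qed.

Lemma eqX_sym p q : eqX n p q -> eqX n q p.
Proof. by move=> H i /H. Qed.

Lemma eqX_trans p q r : eqX n p q -> eqX n q r -> eqX n p r.
Proof. by move=> H H' i ltin; rewrite H ?H'. Qed.

Lemma eqXM p q p' q' : eqX n p p' -> eqX n q q' -> eqX n (p * q) (p' * q').
Proof.
move=> Hp Hq i ltin; rewrite !coefM; apply: eq_bigr => j _.
by rewrite Hp ?Hq //; have := ltn_ord j; lia.
Qed.

Lemma eqX_prod (I : eqType) (r : seq I) (P : pred I) (F G : I -> {poly R}) :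
  (forall i, i \in r -> P i -> eqX n (F i) (G i)) ->
  eqX n (\prod_(i <- r | P i) F i) (\prod_(i <- r | P i) G i).
Proof.
move=> H; rewrite big_seq_cond [X in eqX _ _ X]big_seq_cond.
by apply: (big_ind2 (eqX n)) => [//|????|i /andP[]]; [exact: eqXM | exact: H].
Qed.

(** The product telescopes to [1 - 'X^(k * n)], and [k * n] is at least [n]: the truncated geometric
    series inverts [1 - 'X^k]. *)
Lemma eqX_geom k : (0 < k)%N ->
  eqX n ((\sum_(j < n) 'X^(k * j)) * (1 - 'X^k)) (1 : {poly R}).
Proof.
move=> k0 i ltin.
under eq_bigr => j _ do rewrite exprM.
rewrite -opprB mulrN mulrC -subrX1 opprB coefB -exprM coefXn.
by rewrite (_ : (i == k * n)%N = false) ?subr0 //; nia.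
Qed.

Lemma eqX_sum_widen (F : nat -> {poly R}) a b : (a <= b)%N ->
  (forall m, (a <= m < b)%N -> eqX n (F m) 0) ->
  eqX n (\sum_(m < b) F m) (\sum_(m < a) F m).
Proof.
move=> leab F0 i ltin; rewrite !coef_sum.
rewrite -!(big_mkord predT (fun m => (F m)`_i)) (@big_cat_nat _ _ _ a) //=.
rewrite [X in _ + X]big_nat_cond [X in _ + X]big1 ?addr0 // => m.
by rewrite andbT => Hm; rewrite (F0 m Hm) // coef0.
Qed.

Lemma eqX_prod_widen (F G : nat -> {poly R}) a b : (a <= b)%N ->
  (forall m, (0 < m <= a)%N -> eqX n (F m) (G m)) ->
  (forall m, (a < m <= b)%N -> eqX n (F m) 1) ->
  eqX n (\prod_(1 <= m < b.+1) F m) (\prod_(1 <= m < a.+1) G m).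
Proof.
move=> leab FG F1; rewrite (@big_cat_nat _ _ _ a.+1) //=.
rewrite -[X in eqX _ _ X]mulr1; apply: eqXM.
  by apply: eqX_prod => m; rewrite mem_index_iota => Hm _; apply: FG.
rewrite -[X in eqX _ _ X](big1_eq (op := *%R) (index_iota a.+1 b.+1) predT).
by apply: eqX_prod => m; rewrite mem_index_iota => Hm _; apply: F1.
Qed.

Lemma eqXZXn c k : (n <= k)%N -> eqX n (c *: 'X^k) (0 : {poly R}).
Proof.
by move=> lenk i ltin; rewrite coefZ coefXn coef0 ltn_eqF ?mulr0 //; lia.
Qed.

Lemma eqX_1subXn k : (n <= k)%N -> eqX n (1 - 'X^k) (1 : {poly R}).
Proof.
by move=> lenk i ltin; rewrite coefB coefXn ltn_eqF ?subr0 //; lia.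
Qed.
End EqX.

(** * Indices divisible by [l] and the substitution of ['X^l] for X *)

(** With [m <= 1] the lower bound is unchanged by division by [l]: 0 serves the coefficient sum
    below, 1 serves the products. *)
Lemma big_nat_dvd (R : Type) (idx : R) (op : Monoid.law idx) (F : nat -> R)
    l m n : (0 < l)%N -> (m <= 1)%N ->
  \big[op/idx]_(m <= k < n.+1 | (l %| k)%N) F k =
  \big[op/idx]_(m <= i < (n %/ l).+1) F (l * i)%N.
Proof.
move=> l0 m1; elim: n => [|n IHn].
  rewrite div0n; case: m m1 => [|[|//]] _; last by rewrite !big_geq.
  by rewrite big_mkcond !big_nat1 dvdn0 muln0.
rewrite big_mkcond /= in IHn.
rewrite big_mkcond big_nat_recr /=; last by lia.
rewrite IHn divnS //.
case: ifP => [ldvd|_]; last by rewrite Monoid.mulm1.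
rewrite add1n [RHS]big_nat_recr /=; last by apply: leq_trans m1 _.
by congr (op _ (F _)); rewrite -[in LHS](divnK ldvd) divnS // ldvd mulnC.
Qed.

Lemma sum_divn (V : nmodType) (F : nat -> nat -> V) l a :
  (0 < l)%N ->
  \sum_(i < a) \sum_(b < l) F i (l * i + b)%N =
  \sum_(m < a * l) F (m %/ l)%N m.
Proof.
move=> l0; elim: a => [|a IHa]; first by rewrite mul0n !big_ord0.
rewrite big_ord_recr IHa mulSnr big_split_ord /=; congr (_ + _).
apply: eq_bigr => b _; rewrite mulnC.
by rewrite divnMDl // divn_small ?addn0.
Qed.

Lemma coef_comp_Xn_mul (R : comNzRingType) (p q : {poly R}) l n : (0 < l)%N ->
  ((p \Po 'X^l) * q)`_n =
  \sum_(0 <= d < (n %/ l).+1) p`_d * q`_(n - l * d).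
Proof.
move=> l0; rewrite coefM.
rewrite -(big_mkord predT (fun j => (p \Po 'X^l)`_j * q`_(n - j))).
transitivity (\sum_(0 <= j < n.+1 | (l %| j)%N) p`_(j %/ l) * q`_(n - j)).
  rewrite [RHS]big_mkcond; apply: eq_bigr => j _.
  by rewrite coef_comp_poly_Xn //; case: ifP; rewrite ?mul0r.
by rewrite big_nat_dvd //; apply: eq_bigr => d _; rewrite mulKn.
Qed.

(** * The factor belonging to each part size, and the product of these factors *)

Section RegularProduct.
Variables (R : comNzRingType) (w : nat -> nat -> R) (l n : nat).
Hypotheses (l0 : (0 < l)%N) (w0 : forall k, w k 0 = 1)
  (w1 : forall k m, (l %| k)%N -> w k m = 1).

(** The value 0 discards the non-regular partitions, so that sums can run over all partitions and
    factor as products. *)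
Definition regw k m : R := if (l %| k)%N && (0 < m)%N then 0 else w k (m %/ l).

Let A k : {poly R} := \sum_(m < n.+1) regw k m *: 'X^(k * m).
Let W k : {poly R} := \sum_(m < n.+1) w k m *: 'X^(k * m).
Let E k : {poly R} := \sum_(j < n.+1) 'X^(k * j).

Let W_comp k : W k \Po 'X^l = \sum_(m < n.+1) w k m *: 'X^(l * k * m).
Proof.
rewrite /W raddf_sum; apply: eq_bigr => m _ /=.
by rewrite linearZ /= comp_Xn_poly -exprM mulnA.
Qed.

(** For [l] dividing [k], [A k] is 1 and [W k] at ['X^l] inverts [1 - 'X^(l * k)]; the extra [E k]
    on the left lets the right side keep one form for all [k]. Otherwise multiplicities are divided
    by [l] with remainder. *)
Lemma regw_factor k : (0 < k)%N ->
  eqX n.+1 (A k * (if (l %| k)%N then E k else 1))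
           (E k * (1 - 'X^(l * k)) * (W k \Po 'X^l)).
Proof.
move=> k0; rewrite W_comp; case: ifP => [ldvd|ndvd].
  have -> : A k = 1.
    rewrite /A big_ord_recl big1 ?addr0; last first.
      by move=> i _; rewrite /regw ldvd /= scale0r.
    by rewrite /regw andbF div0n w0 muln0 expr0 scale1r.
  rewrite mul1r -mulrA -[X in eqX _ X _]mulr1; apply: eqXM => //.
  apply: eqX_sym; rewrite mulrC.
  under eq_bigr => m _ do rewrite w1 // scale1r.
  by apply: eqX_geom; rewrite muln_gt0 l0.
(* [B] runs over the remainders modulo [l], the composed [W k] over the quotients. *)
pose B : {poly R} := \sum_(b < l) 'X^k ^+ b.
have -> : 1 - 'X^(l * k) = (1 - 'X^k) * B :> {poly R}.
  by rewrite -opprB mulnC exprM subrX1 -mulNr opprB.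
rewrite mulr1 mulrA -mulrA -[X in eqX _ X _]mul1r; apply: eqXM.
  by apply: eqX_sym; apply: eqX_geom.
have -> : B * (\sum_(m < n.+1) w k m *: 'X^(l * k * m)) =
    \sum_(m < n.+1 * l) w k (m %/ l) *: 'X^(k * m).
  rewrite -(sum_divn (fun i m => w k i *: 'X^(k * m))) // mulr_sumr.
  apply: eq_bigr => a _; rewrite mulr_suml; apply: eq_bigr => b _.
  by rewrite -scalerAr -exprM -exprD; congr (_ *: 'X^_); nia.
(* The terms beyond those of [A k] have m > n, hence degree k m > n. *)
apply: eqX_sym; rewrite /A /regw ndvd /=.
apply: (eqX_sum_widen (F := fun m => w k (m %/ l) *: 'X^(k * m))).
  by rewrite leq_pmulr.
by move=> m Hm; apply: eqXZXn; nia.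
Qed.

(** The compensating [E k] with [l] dividing [k] multiply to P(q^l); clearing them supplies the
    second factor 1/P(q^l) on the right, the first coming from [regw_factor]. *)
Lemma regw_prod :
  eqX n.+1 (\prod_(1 <= k < n.+1) A k)
    ((\prod_(1 <= k < n.+1) W k \Po 'X^l) *
     (\prod_(1 <= k < n.+1) E k * \prod_(1 <= i < n.+1) (1 - 'X^(l * i)) ^+ 2)).
Proof.
pose D : {poly R} := \prod_(1 <= i < n.+1) (1 - 'X^(l * i)).
have Einv : eqX n.+1
    (\prod_(1 <= k < n.+1) (if (l %| k)%N then E k else 1) * D) 1.
  rewrite -big_mkcond big_nat_dvd // /D.
  (* Factors of [D] with i > n/l differ from 1 only in degree l i > n. *)
  have HD : eqX n.+1 D (\prod_(1 <= i < (n %/ l).+1) (1 - 'X^(l * i))).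
    apply: eqX_prod_widen => [|//|m]; first exact: leq_div.
    move=> Hm; apply: eqX_1subXn; have := ltn_ceil n l0; nia.
  apply: eqX_trans (eqXM _ HD) _ => //; rewrite -big_split /=.
  rewrite -[X in eqX _ _ X](big1_eq (op := *%R)
    (index_iota 1 (n %/ l).+1) predT).
  apply: eqX_prod => i; rewrite mem_index_iota => Hi _.
  by apply: eqX_geom; rewrite muln_gt0 l0; lia.
rewrite prodrXl -/D rmorph_prod.
have H : eqX n.+1
    (\prod_(1 <= k < n.+1) (A k * (if (l %| k)%N then E k else 1)))
    (\prod_(1 <= k < n.+1) (E k * (1 - 'X^(l * k)) * (W k \Po 'X^l))).
  apply: eqX_prod => k; rewrite mem_index_iota => /andP[k0 _] _.
  exact: regw_factor.
rewrite !big_split /= -/D in H.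
rewrite -[X in eqX _ X _]mulr1.
apply: eqX_trans (eqXM (@eqX_refl _ _ _) (eqX_sym Einv)) _.
rewrite mulrA; apply: eqX_trans (eqXM H (@eqX_refl _ _ D)) _.
set e := \prod_(1 <= i < n.+1) E i; set c := \prod_(1 <= i < n.+1) (_ \Po _).
by have -> : c * (e * D ^+ 2) = e * D * c * D by ring.
Qed.
End RegularProduct.

(** [coefPl] truncates at its own degree [N], which varies with d; a common truncation at [n]
    matches [regw_prod]. *)
Lemma coefPl_widen l N n : (0 < l)%N -> (N <= n)%N -> coefPl l N =
  ((\prod_(1 <= i < n.+1) (\sum_(j < n.+1) 'X^(i * j) : {poly int}))
   * (\prod_(1 <= i < n.+1) (1 - 'X^(l * i)) ^+ 2))`_N.
Proof.
move=> l0 leNn; rewrite /coefPl; apply/esym.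
refine ((_ : eqX N.+1 _ _) N (ltnSn N)).
have E_widen a i : (a <= n)%N -> (N < i * a.+1)%N -> (0 < i)%N ->
    eqX N.+1 (\sum_(j < n.+1) 'X^(i * j) : {poly int})
             (\sum_(j < a.+1) 'X^(i * j)).
  move=> lean ltN i0.
  apply: (eqX_sum_widen (F := fun j => 'X^(i * j))); first by lia.
  by move=> m Hm; rewrite -['X^_]scale1r; apply: eqXZXn; nia.
apply: eqXM; apply: eqX_prod_widen => // i Hi.
- by apply: E_widen; nia.
(* For i > N only the term j = 0 has degree at most N. *)
- apply: eqX_trans (E_widen 0%N i _ _ _) _; try lia.
  by rewrite big_ord1 muln0.
- by rewrite expr2 -[X in eqX _ _ X]mul1r; apply: eqXM; apply: eqX_1subXn; nia.
Qed.

(** * The weights w_k and their prime factorization *)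

Definition wt (l k m : nat) : nat := (lk l k ^ m * (m`!)`_(\pi(lk l k)))%N.

(** Primes of [l] that do not divide [y] enter with exponent 0. *)
Lemma prod_primes_widen l y : (0 < y)%N -> {subset primes y <= primes l} ->
  y = (\prod_(p <- primes l) p ^ logn p y)%N.
Proof.
move=> y0 sub; rewrite {1}(prod_prime_decomp y0) prime_decompE big_map /=.
rewrite [RHS](bigID (mem (primes y))) /= [X in (_ * X)%N]big1 ?muln1; last first.
  by move=> p; rewrite -logn_gt0 -eqn0Ngt => /eqP->.
rewrite -[RHS]big_filter; apply: perm_big; apply: uniq_perm.
- exact: primes_uniq.
- by rewrite filter_uniq ?primes_uniq.
by move=> p; rewrite mem_filter andb_idr //; apply: sub.
Qed.

Lemma lk_gt0 l k : (0 < l)%N -> (0 < lk l k)%N.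
Proof. by move=> l0; rewrite divn_gt0 ?gcdn_gt0 ?l0 // dvdn_leq // dvdn_gcdl. Qed.

Lemma wt_gt0 l k m : (0 < l)%N -> (0 < wt l k m)%N.
Proof. by move=> l0; rewrite muln_gt0 expn_gt0 lk_gt0 // part_gt0. Qed.

Lemma wt0 l k : wt l k 0 = 1%N.
Proof. by rewrite /wt expn0 fact0 partn1. Qed.

Lemma wt_dvd l k m : (0 < l)%N -> (l %| k)%N -> wt l k m = 1%N.
Proof.
move=> l0 ldvd; rewrite /wt /lk (gcdn_idPl ldvd) divnn l0 exp1n mul1n.
by apply/eqP; rewrite partn_eq1 ?fact_gt0 //; apply/pnatP => //; rewrite fact_gt0.
Qed.

Lemma logn_lk p l k : (0 < l)%N -> (0 < k)%N ->
  logn p (lk l k) = (logn p l - logn p k)%N.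
Proof.
move=> l0 k0; rewrite /lk logn_div ?dvdn_gcdl // logn_gcd //; lia.
Qed.

Lemma logn_partn p (pi : nat_pred) m :
  logn p (m`_pi) = (if p \in pi then logn p m else 0)%N.
Proof.
case: ifPn => ppi.
  rewrite -logn_part partn_part ?logn_part //.
  by move=> q; rewrite inE => /eqP->.
apply/eqP; rewrite eqn0Ngt logn_gt0; apply: contra ppi.
exact: (pnatPpi (part_pnat pi m)).
Qed.

(** A prime p divides [lk l k] exactly when [logn p k < logn p l], so the set pi_k and the range of
    the product agree; Legendre's formula turns the factorial into [d_p]. *)
Lemma wt_prod l k m : (0 < l)%N -> (0 < k)%N -> wt l k m =
  (\prod_(p <- primes l | logn p k < logn p l)
     p ^ ((logn p l - logn p k) * m + d_p p m))%N.
Proof.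
move=> l0 k0; have w0 := wt_gt0 k m l0.
have logw p : prime p -> logn p (wt l k m) =
    (if logn p k < logn p l then (logn p l - logn p k) * m + d_p p m else 0)%N.
  move=> pp; rewrite /wt lognM ?expn_gt0 ?lk_gt0 ?part_gt0 // lognX logn_partn.
  rewrite -[p \in _]logn_gt0 logn_lk // subn_gt0 mulnC.
  case: ifP => [_|]; first by rewrite logn_fact.
  by move/negbT; rewrite -leqNgt -subn_eq0 => /eqP->.
rewrite (prod_primes_widen (l := l) w0); last first.
  move=> p pw; have pp : prime p by move: pw; rewrite mem_primes => /and3P[].
  by move: pw; rewrite -!logn_gt0 logw //; case: ifP => // H _; lia.
rewrite [RHS]big_mkcond big_seq [RHS]big_seq; apply: eq_bigr => p.
by rewrite mem_primes => /and3P[pp _ _]; rewrite logw //; case: ifP.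
Qed.

Lemma thetaE l la : (0 < l)%N ->
  theta l la = (\prod_(1 <= k < (sumn la).+1) wt l k (mult k la))%N.
Proof.
move=> l0; rewrite /theta /theta_pr.
rewrite (exchange_big_dep predT) //=; apply: eq_big_nat => k /andP[k0 _].
by rewrite wt_prod.
Qed.

(** * Power sums and the recovery of multiplicities *)

Lemma sum_reg_partitions (R : comNzRingType) l n s : (0 < l)%N ->
  \sum_(mu <- reg_partitions l n) (r_l l mu)%:R ^+ s =
  \sum_(mu <- partitions n) \prod_(1 <= k < n.+1)
     regw (fun k m => (wt l k m)%:R ^+ s : R) l k (mult k mu).
Proof.
move=> l0; rewrite /reg_partitions big_filter big_mkcond big_seq [RHS]big_seq.
apply: eq_bigr => mu /partitionsP[/allP Hmu smu].
case: ifPn => [/allP reg | /allPn[k kmu ldvd]].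
  rewrite /r_l smu natr_prod -prodrXl; apply: eq_big_nat => k Hk.
  rewrite /regw; case: ifP => // /andP[ldvd].
  rewrite /mult -has_count has_pred1 => /reg.
  by rewrite ldvd.
(* The part [k] divisible by [l] contributes a zero factor. *)
rewrite (bigD1_seq k) ?iota_uniq //=; last first.
  by rewrite mem_index_iota; apply: Hmu.
rewrite /regw (negbNE ldvd) /mult -has_count has_pred1 kmu mul0r //.
Qed.

(** The s-th powers of the weights are again 1 at multiplicity 0 and at multiples of [l], so
    [regw_prod] applies to them; the two sides are the coefficients of ['X^n] in its two members. *)
Lemma sum_powers l n s : (0 < l)%N ->
  \sum_(mu <- reg_partitions l n) (r_l l mu)%:R ^+ s =
  \sum_(0 <= d < (n %/ l).+1) \sum_(la <- partitions d)
     mlnd l n d * (theta l la)%:R ^+ s.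
Proof.
move=> l0; rewrite sum_reg_partitions //.
pose w k m : int := (wt l k m)%:R ^+ s.
have w0 k : w k 0%N = 1 by rewrite /w wt0 expr1n.
have w1 k m : (l %| k)%N -> w k m = 1 by move=> ?; rewrite /w wt_dvd ?expr1n.
rewrite -(coef_prod_partitions (F := regw w l) (k := n)) //; last first.
  by move=> k; rewrite /regw andbF div0n w0.
rewrite (regw_prod l0 w0 w1 (ltnSn n)) coef_comp_Xn_mul //.
apply: eq_big_nat => d Hd.
rewrite coef_prod_partitions //; last by have := leq_divM n l; nia.
rewrite /mlnd (coefPl_widen l0 (leq_subr (l * d) n)) mulrC mulr_sumr.
rewrite big_seq [RHS]big_seq; apply: eq_bigr => la /partitionsP[_ sla].
by rewrite thetaE // sla natr_prod -prodrXl.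
Qed.

(* Evaluate a polynomial vanishing at every other value of [S]. *)
Lemma power_sums_inj (S : seq (int * nat)) :
  (forall s, \sum_(x <- S) x.1 * x.2%:R ^+ s = 0) ->
  forall v, \sum_(x <- S) (x.2 == v)%:R * x.1 = 0.
Proof.
move=> H v.
have Hp (p : {poly int}) : \sum_(x <- S) x.1 * p.[x.2%:R] = 0.
  under eq_bigr => x _ do rewrite horner_coef mulr_sumr.
  rewrite exchange_big big1 //= => i _.
  under eq_bigr => x _ do rewrite mulrCA.
  by rewrite -mulr_sumr H mulr0.
pose p : {poly int} := \prod_(x <- S | x.2 != v) ('X - x.2%:R%:P).
have pv : p.[v%:R] != 0.
  rewrite horner_prod prodf_seq_neq0; apply/allP => x _; apply/implyP => xv.
  by rewrite hornerXsubC subr_eq0 Num.Theory.eqr_nat eq_sym.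
(* Cancelling the nonzero integer p(v) replaces Lagrange normalization, which would require
   fractions. *)
apply: (mulIf pv); rewrite mul0r -[RHS](Hp p) mulr_suml.
rewrite big_seq [RHS]big_seq; apply: eq_bigr => x Sx.
case: eqP => [-> | /eqP xv]; first by rewrite mul1r.
suff /eqP-> : p.[x.2%:R] == 0 by rewrite !mul0r mulr0.
rewrite horner_prod prodf_seq_eq0; apply/hasP; exists x => //.
by rewrite xv hornerXsubC subrr eqxx.
Qed.

Unset Implicit Arguments.

(* Multiset equality expressed as equality of multiplicities of every value v. *)
Theorem theorem5p2 (l n : nat) (hl : (2 <= l)%N) :
  forall v : nat,
    (count (fun mu => r_l l mu == v) (reg_partitions l n))%:Z =
    \sum_(0 <= d < (n %/ l).+1)
       \sum_(la <- partitions d) ((theta l la == v)%:Z * mlnd l n d).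
Proof.
move=> v; have l0 : (0 < l)%N by apply: ltnW.
(* Signed multiset: values of [r_l] count +1, values of [theta] count minus their multiplicity. The
   claim becomes that every value has total weight zero. *)
pose S := [seq (1%:Z, r_l l mu) | mu <- reg_partitions l n] ++
  [seq (- mlnd l n d, theta l la) | d <- index_iota 0 (n %/ l).+1,
                                    la <- partitions d].
have sumS (F : int -> nat -> int) : \sum_(x <- S) F x.1 x.2 =
    \sum_(mu <- reg_partitions l n) F 1 (r_l l mu) +
    \sum_(0 <= d < (n %/ l).+1) \sum_(la <- partitions d)
       F (- mlnd l n d) (theta l la).
  by rewrite big_cat big_map big_allpairs_dep.
have /eqP : \sum_(x <- S) (x.2 == v)%:R * x.1 = 0.
  apply: power_sums_inj => s; rewrite (sumS (fun c x => c * x%:R ^+ s)).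
  under eq_bigr => mu _ do rewrite mul1r.
  rewrite sum_powers // -big_split big1 // => d _ /=.
  by rewrite -big_split big1 // => la _ /=; rewrite mulNr addrN.
rewrite (sumS (fun c x => (x == v)%:R * c)) addr_eq0 => /eqP H.
transitivity (\sum_(mu <- reg_partitions l n) (r_l l mu == v)%:R * 1 : int).
  rewrite -sum1_count big_mkcond -natz natr_sum /=.
  by apply: eq_bigr => mu _; rewrite mulr1; case: eqP.
rewrite H -sumrN; apply: eq_bigr => d _; rewrite -sumrN.
by apply: eq_bigr => la _; rewrite mulrN opprK natz.
Qed.
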